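(* Let $q>1$ and $p\ge2$. In the sequence model $Y_\lambda=\theta_\lambda+\varepsilon\xi_\lambda$, let $\mathcal M$ be a non-empty collection of subsets of $\Lambda^{(N)}$, let $x_{m_j}\ge1$ be given for each $j\in\mathcal J$ and $m_j\in\mathcal M_j$, and let $\tilde\theta=\hat\theta^{(\hat m)}$ be the PCO estimator associated with the penalty $$\mathrm{pen}(m)=2\varepsilon^p\sum_{j\in\mathcal J}\omega_j\min\Big(\mathrm p_j(m_j),\,(2q\log N)^{\frac p2-1}\mathrm p_j^\#(m_j)\Big),$$ where $$\mathrm p_j(m_j)=\frac32\sigma_p^p|m_j|+\kappa_p2^{\frac p2-1}x_{m_j}^{\frac p2},\qquad \mathrm p_j^\#(m_j)=\frac32\sigma_2^2|m_j|+\kappa_2x_{m_j}.$$ Then $$\mathbb E\big[\|\tilde\theta-\theta\|_p^p\big]\le\tilde M_p\inf_{m\in\mathcal M}\Big\{\mathbb E\big[\|\hat\theta^{(m)}-\theta\|_p^p\big]+\mathrm{pen}(m)\Big\}+\breve M_{p,q}\Big(N^{1-q}\|\theta\|_p^p+\varepsilon^pR^\#(\mathcal M)\Big),$$ with $\tilde M_p$ a constant depending only on $p$, $\breve M_{p,q}$ a constant depending only on $p$, $\sigma_p$ and $q$, and $$R^\#(\mathcal M)=N^{(1-q)/2}\sum_{\lambda\in\Lambda^{(N)}}w_\lambda+(\log N)^{\frac p2-1}R(\mathcal M),\qquad R(\mathcal M)=\sum_{j\in\mathcal J}\omega_j\sum_{m_j\in\mathcal M_j,\ m_j\ne\emptys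et}e^{-x_{m_j}}.$$
   Context: Model: $\Lambda$ is a countable set, $\Lambda^{(N)}$ is the set of its first $N$ elements, $0<\varepsilon\le 1$, $\theta=(\theta_\lambda)_{\lambda\in\Lambda}$ is an unknown real sequence, and $Y_\lambda=\theta_\lambda+\varepsilon\xi_\lambda$, where the $\xi_\lambda$ are i.i.d. centered real random variables with $\mathbb P(|\xi_\lambda|\ge t)\le 2e^{-t^2/2}$ for all $t\ge0$. $\sigma_u=(\mathbb E|\xi_\lambda|^u)^{1/u}>0$ for $u\ge1$. Norm: $w=(w_\lambda)_{\lambda\in\Lambda}$ are non-negative weights and $\|\vartheta\|_p^p=\sum_{\lambda\in\Lambda}w_\lambda|\vartheta_\lambda|^p$. It is assumed that $\|\theta\|_p<\infty$. Estimators: for $m\subset\Lambda^{(N)}$, $\hat\theta^{(m)}=(Y_\lambda\mathbf 1_{\{\lambda\in m\}})_{\lambda\in\Lambda}$. The PCO estimator associated with $\mathrm{pen}$ is $\tilde\theta=\hat\theta^{(\hat m)}$, where $\hat m$ is a minimizer over $m\in\mathcal M$ of $-\sum_{\lambda\in m}w_\lambda|Y_\lambda|^p+\mathrm{pen}(m)$. Partition: $\Lambda^{(N)}=\bigcup_{j\in\mathcal J}\Lambda_j$ is the partition into the level sets of the weights: $w_\lambda=\omega_j$ for all $\lambda\in\Lambda_j$, and $\omega_j\ne\omega_{j'}$ if $j\ne j'$. For $m\in\mathcal M$, $m_j=m\cap\Lambda_j$, and $\mathcal M_j=\{m_j:\ m\in\mathcal M\}$. $|\cdot|$ is cardinality,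 $(u)_+=\max(u,0)$, and $0^0=1$. Constants $\kappa_u$ ($u=p$ and $u=2$): $\kappa_u=c_{2,u}+c_{1,u}\max(1,c_{1,u}/(2\sigma_u^u))$, where $c_{1,u},c_{2,u}>0$ are constants depending only on $u$ such that, for every finite family $(\xi_\lambda)_{\lambda\in\mathcal I}$, $|\mathcal I|=D$, of i.i.d. centered variables with $\mathbb P(|\xi_\lambda|\ge t)\le2e^{-t^2/2}$ for all $t\geq 0$, and every $x>0$, $\mathbb P\big(\big|\sum_{\lambda\in\mathcal I}|\xi_\lambda|^u-D\sigma_u^u\big|\ge c_{1,u}\sqrt{Dx}+c_{2,u}D^{(1-u/2)_+}x^{u/2}\big)\le2e^{-x}$ (such constants exist). Consequently, for every $x\ge1$, $\sum_{\lambda\in\mathcal I}|\xi_\lambda|^u\le\frac32\sigma_u^uD+\kappa_uD^{(1-u/2)_+}x^{u/2}$ with probability at least $1-2e^{-x}$. *)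

(* Defs.v *)
From HB Require Import structures.
From mathcomp Require Import all_boot all_order all_algebra finmap.
From mathcomp Require Import all_classical all_reals all_analysis.

Set Implicit Arguments.
Unset Strict Implicit.
Unset Printing Implicit Defensive.

Import Order.TTheory GRing.Theory Num.Theory.
Import numFieldNormedType.Exports.

Local Open Scope classical_set_scope.
Local Open Scope ring_scope.

(* Mutual independence: product rule over every finite subfamily. *)
Definition mutually_independent (R : realType) (d : measure_display)
    (T : measurableType d) (P : probability T R) (I : choiceType)
    (X : I -> {RV P >-> R}) : Prop :=
  forall (F : {fset I}) (A : I -> set R),
    (forall i, i \in F -> measurable (A i)) ->
    P (\bigcap_(i in [set` F]) (X i @^-1` A i)) =
    (\prod_(i <- F) fine (P (X i @^-1` A i)))%:E.

Definition iid (R : realType) (d : measure_display) (T : measurableType d)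
    (P : probability T R) (I : choiceType) (X : I -> {RV P >-> R}) : Prop :=
  mutually_independent X /\
  (forall (i j : I) (A : set R), measurable A ->
     distribution P (X i) A = distribution P (X j) A).

(* The i.i.d. noise: centered, with P(|xi| >= t) <= 2 exp(- t^2 / 2). *)
Definition iid_noise (R : realType) (d : measure_display)
    (T : measurableType d) (P : probability T R) (I : choiceType)
    (xi : I -> {RV P >-> R}) : Prop :=
  [/\ iid xi,
      (forall i, 'E_P[xi i] = 0)%E &
      forall (i : I) (t : R), 0 <= t ->
        (P [set o | (t <= `|xi i o|)%R] <= (2 * expR (- (t ^+ 2 / 2)))%:E)%E].

(* s = sigma_u = (E |xi_i|^u)^(1/u) for every i; on an empty family this puts
   no constraint on s. *)
Definition noise_norm (R : realType) (d : measure_display)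
    (T : measurableType d) (P : probability T R) (I : choiceType)
    (xi : I -> {RV P >-> R}) (u s : R) : Prop :=
  forall i, Lnorm P u%:E (EFin \o xi i) = s%:E.

(* (c1, c2) = (c_{1,u}, c_{2,u}); the constants must serve all probability
   spaces and all finite families, whatever the common law of the variables. *)
Definition deviation_constants (R : realType) (u c1 c2 : R) : Prop :=
  [/\ 0 < c1, 0 < c2 &
    forall (d : measure_display) (T : measurableType d) (P : probability T R)
      (I : finType) (xi : I -> {RV P >-> R}) (s x : R),
      iid_noise xi -> noise_norm xi u s -> 0 < x ->
      let D : R := #|I|%:R in
      (P [set o | (c1 * Num.sqrt (D * x)
                    + c2 * D `^ Num.max (1 - u / 2) 0 * x `^ (u / 2)
                  <= `|\sum_(i : I) `|xi i o| `^ u - D * s `^ u|)%R]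
       <= (2 * expR (- x))%:E)%E].

Definition kappa (R : realType) (c1 c2 sigma : R -> R) (u : R) : R :=
  c2 u + c1 u * Num.max 1 (c1 u / (2 * sigma u `^ u)).

(* [rk l] is the position of [l] in an enumeration of the countable set. *)
Definition enumeration (Lam : choiceType) (rk : Lam -> nat) : Prop :=
  injective rk /\ forall (l : Lam) (k : nat), (k < rk l)%N -> exists l', rk l' = k.

Definition first_elements (Lam : choiceType) (rk : Lam -> nat) (N : nat)
  : {fset Lam} := fset_set [set l | (rk l < N)%N].

(* The blocks are nonempty, and they are disjoint since omega is injective. *)
Definition level_partition (R : realType) (Lam : choiceType) (w : Lam -> R)
    (A : {fset Lam}) (J : finType) (LamJ : J -> {fset Lam}) (omega : J -> R)
  : Prop :=
  [/\ (forall l, l \in A <-> exists j, l \in LamJ j),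
      (forall j, LamJ j != fset0),
      (forall j l, l \in LamJ j -> w l = omega j) &
      injective omega].

Definition trace (Lam : choiceType) (B m : {fset Lam}) : {fset Lam} :=
  (m `&` B)%fset.

Definition traces (Lam : choiceType) (B : {fset Lam}) (M : {fset {fset Lam}})
  : {fset {fset Lam}} := [fset trace B m | m in M]%fset.

(* ||v||_p^p, possibly infinite *)
Definition wnorm_pow (R : realType) (Lam : choiceType) (w : Lam -> R) (p : R)
    (v : Lam -> R) : \bar R :=
  \esum_(l in [set: Lam]) (w l * `|v l| `^ p)%:E.

Definition obs (R : realType) (d : measure_display) (T : measurableType d)
    (P : probability T R) (Lam : choiceType) (theta : Lam -> R) (eps : R)
    (xi : Lam -> {RV P >-> R}) (o : T) (l : Lam) : R :=
  theta l + eps * xi l o.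

Definition estimator (R : realType) (Lam : choiceType) (y : Lam -> R)
    (m : {fset Lam}) (l : Lam) : R :=
  if l \in m then y l else 0.

(* E ||thetahat^(mhat) - theta||_p^p for a possibly random model mhat *)
Definition risk (R : realType) (d : measure_display) (T : measurableType d)
    (P : probability T R) (Lam : choiceType) (w : Lam -> R) (p : R)
    (theta : Lam -> R) (Y : T -> Lam -> R) (mhat : T -> {fset Lam}) : \bar R :=
  (\int[P]_o
     wnorm_pow w p (fun l => estimator (Y o) (mhat o) l - theta l)%R)%E.

Definition pco_criterion (R : realType) (Lam : choiceType) (w : Lam -> R)
    (p : R) (pen : {fset Lam} -> R) (y : Lam -> R) (m : {fset Lam}) : R :=
  - (\sum_(l <- m) w l * `|y l| `^ p) + pen m.

(* [mhat] is a random (measurable) minimizer of the criterion over M; ties may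
   be broken in any measurable way. *)
Definition pco_selector (R : realType) (d : measure_display)
    (T : measurableType d) (Lam : choiceType) (w : Lam -> R) (p : R)
    (pen : {fset Lam} -> R) (Y : T -> Lam -> R) (M : {fset {fset Lam}})
    (mhat : T -> {fset Lam}) : Prop :=
  (forall m, measurable (mhat @^-1` [set m])) /\
  (forall o, mhat o \in M /\ forall m, m \in M ->
     pco_criterion w p pen (Y o) (mhat o) <= pco_criterion w p pen (Y o) m).

Definition pen_p (R : realType) (Lam : choiceType) (p : R)
    (c1 c2 sigma : R -> R) (x : R) (mj : {fset Lam}) : R :=
  3 / 2 * sigma p `^ p * #|` mj|%:R
  + kappa c1 c2 sigma p * 2 `^ (p / 2 - 1) * x `^ (p / 2).

Definition pen_sharp (R : realType) (Lam : choiceType)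
    (c1 c2 sigma : R -> R) (x : R) (mj : {fset Lam}) : R :=
  3 / 2 * sigma 2 ^+ 2 * #|` mj|%:R + kappa c1 c2 sigma 2 * x.

Definition pen (R : realType) (Lam : choiceType) (J : finType)
    (LamJ : J -> {fset Lam}) (omega : J -> R) (x : J -> {fset Lam} -> R)
    (p q eps : R) (N : nat) (c1 c2 sigma : R -> R) (m : {fset Lam}) : R :=
  2 * eps `^ p * \sum_(j : J) omega j *
    (let mj := trace (LamJ j) m in
     Num.min (pen_p p c1 c2 sigma (x j mj) mj)
       ((2 * q * ln N%:R) `^ (p / 2 - 1) * pen_sharp c1 c2 sigma (x j mj) mj)).

Definition Rrem (R : realType) (Lam : choiceType) (J : finType)
    (LamJ : J -> {fset Lam}) (omega : J -> R) (x : J -> {fset Lam} -> R)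
    (M : {fset {fset Lam}}) : R :=
  \sum_(j : J) omega j *
    \sum_(mj <- traces (LamJ j) M | mj != fset0) expR (- x j mj).

Definition Rrem_sharp (R : realType) (Lam : choiceType) (J : finType)
    (LamJ : J -> {fset Lam}) (omega : J -> R) (x : J -> {fset Lam} -> R)
    (M : {fset {fset Lam}}) (w : Lam -> R) (A : {fset Lam}) (p q : R) (N : nat)
  : R :=
  N%:R `^ ((1 - q) / 2) * (\sum_(l <- A) w l)
  + (ln N%:R) `^ (p / 2 - 1) * Rrem LamJ omega x M.

(* Main.v *)
(** Let [e = eps xi], [S_u(B)] the sum of [|xi_l|^u] over a block [B], and
    compare the selected model [mh] with a competitor [m], both in [M].  From
    [(u + v)^p <= 3/2 u^p + C v^p], applied coordinate by coordinate and combined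
    with the minimality of [mh], one gets
    [loss mh <= 2 C loss m + 2 pen m + 4 (sum over mh of w |e|^p - pen mh / 2)].
    The last bracket is a sum over the blocks of the excess of [S_p(mh_j)] over
    the minimum of the two penalties.  As long as no noise coordinate among the
    first [N] reaches [sqrt (2 q log N)], [S_p <= (2 q log N)^(p/2-1) S_2], so the
    excess is bounded by the positive parts of [S_p - p_j] and of [S_2 - p_j#];
    summed over all nonempty [m_j], their means are controlled by [exp (- x_mj)]
    through the deviation inequality.  The exceptional event has probability at
    most [2 N^(1-q)]; there the loss is bounded by all of the noise plus all of
    the signal, and [|xi|^p 1_E <= (a |xi|^(2p) + 1_E / a) / 2] with
    [a = N^((1-q)/2)] replaces the Cauchy-Schwarz inequality. *)

Require Import Defs.
From mathcomp Require Import all_boot all_order all_algebra finmap.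
From mathcomp Require Import all_classical all_reals all_analysis.
From mathcomp Require Import measurable_realfun ring lra.

Set Implicit Arguments.
Unset Strict Implicit.
Unset Printing Implicit Defensive.

Import Order.TTheory GRing.Theory Num.Theory.
Import numFieldNormedType.Exports.

Local Open Scope classical_set_scope.
Local Open Scope ring_scope.

(** * Nonnegative measurable functions with bounded mean *)

(** Measurability and nonnegativity travel with the bound on the integral, so that estimates can be
    added and scaled without any integrability side condition. *)
Definition mean_le (R : realType) (d : measure_display) (T : measurableType d)
    (P : probability T R) (f : T -> R) (b : R) : Prop :=
  [/\ measurable_fun [set: T] f, forall o, 0 <= f o &
      (\int[P]_o (f o)%:E <= b%:E)%E].

Lemma mean_le_weaken (R : realType) (d : measure_display)
    (T : measurableType d) (P : probability T R) (f : T -> R) (b b' : R) :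
  b <= b' -> mean_le P f b -> mean_le P f b'.
Proof.
by move=> bb' [mf f0 fb]; split => //; apply: le_trans fb _; rewrite lee_fin.
Qed.

Lemma mean_le_le (R : realType) (d : measure_display)
    (T : measurableType d) (P : probability T R) (f g : T -> R) (b : R) :
  mean_le P g b -> measurable_fun [set: T] f -> (forall o, 0 <= f o) ->
  (forall o, f o <= g o) -> mean_le P f b.
Proof.
move=> [mg g0 gb] mf f0 fg; split => //; apply: le_trans gb.
apply: ge0_le_integral => //.
- by move=> o _; rewrite lee_fin.
- exact/measurable_EFinP.
- exact/measurable_EFinP.
- by move=> o _; rewrite lee_fin.
Qed.

Lemma mean_leD (R : realType) (d : measure_display) (T : measurableType d)
    (P : probability T R) (f g : T -> R) (a b : R) :
  mean_le P f a -> mean_le P g b -> mean_le P (fun o => f o + g o) (a + b).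
Proof.
move=> [mf f0 fa] [mg g0 gb]; split; first exact: measurable_funD.
  by move=> o; exact: addr_ge0.
under eq_integral do rewrite EFinD.
rewrite ge0_integralD//; first by rewrite EFinD leeD.
- by move=> o _; rewrite lee_fin.
- exact/measurable_EFinP.
- by move=> o _; rewrite lee_fin.
- exact/measurable_EFinP.
Qed.

Lemma mean_leZ (R : realType) (d : measure_display) (T : measurableType d)
    (P : probability T R) (k : R) (f : T -> R) (b : R) :
  0 <= k -> mean_le P f b -> mean_le P (fun o => k * f o) (k * b).
Proof.
move=> k0 [mf f0 fb]; split; first exact: measurable_funM.
  by move=> o; exact: mulr_ge0.
under eq_integral do rewrite EFinM.
rewrite ge0_integralZl_EFin//; first by rewrite EFinM lee_wpmul2l.
- by move=> o _; rewrite lee_fin.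
- exact/measurable_EFinP.
Qed.

Lemma mean_le_cst (R : realType) (d : measure_display) (T : measurableType d)
    (P : probability T R) (c : R) : 0 <= c -> mean_le P (fun=> c) c.
Proof.
move=> c0; split => //.
by have := expectation_cst P c; rewrite unlock /= => ->.
Qed.

Lemma mean_le_sum (R : realType) (d : measure_display) (T : measurableType d)
    (P : probability T R) (I : eqType) (s : seq I) (Q : pred I)
    (f : I -> T -> R) (b : I -> R) :
  (forall i, i \in s -> Q i -> mean_le P (f i) (b i)) ->
  mean_le P (fun o => \sum_(i <- s | Q i) f i o) (\sum_(i <- s | Q i) b i).
Proof.
elim: s => [|i s IHs] fb.
  by rewrite big_nil; under eq_fun do rewrite big_nil; exact: mean_le_cst.
have {IHs} IH : mean_le P (fun o => \sum_(j <- s | Q j) f j o)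
    (\sum_(j <- s | Q j) b j).
  by apply: IHs => j js; apply: fb; rewrite inE js orbT.
rewrite big_cons; under eq_fun do rewrite big_cons.
case: ifP => // Qi; apply: mean_leD => //.
by apply: fb => //; rewrite inE eqxx.
Qed.

Lemma mean_le_indic (R : realType) (d : measure_display) (T : measurableType d)
    (P : probability T R) (A : set T) (b : R) : measurable A ->
  (P A <= b%:E)%E -> mean_le P (\1_A) b.
Proof.
by move=> mA Ab; split => //; rewrite integral_indic// setIT.
Qed.

Lemma measurable_gt_set (R : realType) (d : measure_display)
    (T : measurableType d) (f : T -> R) (c : R) :
  measurable_fun [set: T] f -> measurable [set o | c < f o].
Proof.
move=> mf; rewrite (_ : [set o | _] = f @^-1` `]c, +oo[); last first.
  by apply/seteqP; split => o /=; rewrite in_itv/= andbT.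
by rewrite -[X in measurable X]setTI; apply: mf => //; exact: measurable_itv.
Qed.

Lemma measurable_ge_set (R : realType) (d : measure_display)
    (T : measurableType d) (f : T -> R) (c : R) :
  measurable_fun [set: T] f -> measurable [set o | c <= f o].
Proof.
move=> mf; rewrite (_ : [set o | _] = f @^-1` `[c, +oo[); last first.
  by apply/seteqP; split => o /=; rewrite in_itv/= andbT.
by rewrite -[X in measurable X]setTI; apply: mf => //; exact: measurable_itv.
Qed.

(** * Moments from exponential tails *)

(** Apply [ln t <= t] at [t = y / (2 r)] and multiply by [r]: the linear term is [y / 2], and
    [r ln (2 r)] goes into the constant. *)
Lemma powR_le_expR_half (R : realType) (r : R) : 0 < r ->
  exists C : R, 0 <= C /\ forall y, 0 < y -> y `^ r <= C * expR (y / 2).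
Proof.
move=> r0; exists (expR (r * ln (2 * r))); split; first exact: expR_ge0.
move=> y y0; rewrite -expRD /powR gt_eqF// ler_expR.
have r2 : 0 < 2 * r by rewrite mulr_gt0.
have -> : ln y = ln (y / (2 * r)) + ln (2 * r).
  by rewrite -lnM ?posrE ?divr_gt0// divfK// gt_eqF.
have lny : ln (y / (2 * r)) <= y / (2 * r).
  by apply/ltW/ln_sublinear; rewrite divr_gt0.
have := ler_wpM2l (ltW r0) lny.
rewrite mulrDr (_ : r * (y / (2 * r)) = y / 2); last first.
  by field; rewrite gt_eqF.
by lra.
Qed.

(* Decomposing by the integer k with k < V <= k+1 bounds V^r by a sum of
   indicators whose weights e^{k/2} are absorbed by the tail e^{-k}. *)
Lemma moment_of_tail (R : realType) (r : R) : 0 < r ->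
  exists C : R, 0 <= C /\
  forall (d : measure_display) (T : measurableType d) (P : probability T R)
    (V : T -> R) (a : R),
  measurable_fun [set: T] V -> (forall o, 0 <= V o) -> 0 <= a ->
  (forall k : nat, (P [set o | (k%:R < V o)%R] <= (a * expR (- k%:R))%:E)%E) ->
  mean_le P (fun o => V o `^ r) (a * C).
Proof.
move=> r0; have [C [C0 hC]] := powR_le_expR_half r0.
pose z : R := expR (- 2^-1).
have z0 : 0 < z by exact: expR_gt0.
have z1 : z < 1 by rewrite /z expR_lt1 oppr_lt0 invr_gt0.
(* Since [expR ((k + 1) / 2) * expR (- k) = expR 2^-1 * z ^ k], this is the sum of the geometric
   series met at the end. *)
exists (C * expR 2^-1 / (1 - z)); split.
  by rewrite !mulr_ge0// ?expR_ge0// invr_ge0 subr_ge0 ltW.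
move=> d T P V a mV V0 a0 tail; split.
- by apply: (measurableT_comp (measurable_powR _)).
- by move=> o; exact: powR_ge0.
pose A (k : nat) : set T := [set o | k%:R < V o].
have mA k : measurable (A k) by exact: measurable_gt_set.
pose c (k : nat) : R := C * expR (k.+1%:R / 2).
have c0 k : 0 <= c k by rewrite /c mulr_ge0 ?expR_ge0.
pose f (k : nat) (o : T) : \bar R := (c k * \1_(A k) o)%:E.
have f0 k o : (0 <= f k o)%E by rewrite lee_fin mulr_ge0// indicE.
have mf k : measurable_fun [set: T] (f k).
  by apply/measurable_EFinP; apply: measurable_funM.
have Vf o : ((V o `^ r)%:E <= \sum_(k <oo) f k o)%E.
  (* The value [0] lies in no interval [k < V <= k + 1]; there [V ^ r = 0] because [r > 0]. *)
  have [V00|Vpos] := eqVneq (V o) 0.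
    rewrite V00 powR0 ?gt_eqF//; apply: nneseries_ge0 => k _ _; exact: f0.
  have {}Vpos : 0 < V o by rewrite lt_neqAle eq_sym Vpos V0.
  have [k kV Vk] : exists2 k : nat, k%:R < V o & V o <= k.+1%:R.
    have exk : exists n : nat, V o <= n.+1%:R.
      by exists (Num.truncn (V o)); apply/ltW/truncnS_gt.
    (* The least [k] with [V <= k + 1] also satisfies [k < V]: by minimality if [k > 0], by
       positivity of [V] if [k = 0]. *)
    case: (ex_minnP exk) => -[|k] Vk kmin; first by exists 0%N.
    exists k.+1 => //; rewrite ltNge; apply/negP => /kmin.
    by rewrite ltnn.
  have fk : ((V o `^ r)%:E <= f k o)%E.
    rewrite /f indicE mem_set// mulr1 lee_fin.
    apply: (@le_trans _ _ (k.+1%:R `^ r)); last exact: hC.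
    by rewrite ge0_ler_powR ?nnegrE// ltW.
  apply: (le_trans fk); rewrite (nneseriesD1 (n := k))//.
  by rewrite leeDl//; apply: nneseries_ge0 => *; exact: f0.
apply: le_trans.
  apply: (@ge0_le_integral _ _ _ P _ measurableT _ (fun o => \sum_(k <oo) f k o)%E).
  - by move=> o _; rewrite lee_fin powR_ge0.
  - by apply/measurable_EFinP; apply: (measurableT_comp (measurable_powR _)).
  - by apply: ge0_emeasurable_sum => // k o _ _; exact: f0.
  - by move=> o _; exact: Vf.
rewrite integral_nneseries//.
apply: lime_le.
  by apply: is_cvg_nneseries => n _ _; apply: integral_ge0 => o _.
apply: nearW => n.
apply: (@le_trans _ _ (\sum_(0 <= k < n) (geometric (a * (C * expR 2^-1)) z k)%:E)%E).
  apply: lee_sum => k _; have [_ _] := mean_leZ (c0 k) (mean_le_indic (mA k) (tail k)).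
  move=> /le_trans; apply; rewrite lee_fin /c /geometric/= /z.
  have -> : expR (- k%:R) = (expR (k%:R / 2))^-1 * expR (- 2^-1) ^+ k :> R.
    by rewrite -expRN -expRM_natr -expRD; congr expR; field.
  have -> : expR (k.+1%:R / 2) = expR (k%:R / 2) * expR 2^-1 :> R.
    by rewrite -expRD -natr1; congr expR; field.
  rewrite le_eqVlt; apply/orP; left; apply/eqP; field.
  by rewrite gt_eqF// expR_gt0.
rewrite sumEFin lee_fin.
rewrite [X in _ <= X](_ : _ = a * (C * expR 2^-1) / (1 - z)); last by rewrite !mulrA.
by apply: geometric_le_lim; rewrite ?mulr_ge0 ?expR_ge0// ger0_norm ?ltW.
Qed.

(** * Power inequalities for sums *)

(** Choose [e] with [(1 + e)^p = 3/2]. If [v <= e u], the sum is at most [(1 + e) u]; otherwise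
    [u < v / e] and the sum is at most [(1 + 1/e) v]. *)
Lemma powR_add_le (R : realType) (p : R) : 0 < p ->
  exists C : R, 1 <= C /\ forall u v : R, 0 <= u -> 0 <= v ->
    (u + v) `^ p <= 3 / 2 * u `^ p + C * v `^ p.
Proof.
move=> p0; pose e : R := (3 / 2) `^ p^-1 - 1.
have e1p : (1 + e) `^ p = 3 / 2.
  by rewrite /e addrC subrK -powRrM mulVf ?gt_eqF// powRr1//; lra.
have e0 : 0 < e.
  rewrite /e subr_gt0 -[ltLHS](congr1 (fun f => f p^-1) (powR1 R)).
  by rewrite gt0_ltr_powR ?invr_gt0 ?nnegrE//; lra.
have ie0 : 0 < e^-1 by rewrite invr_gt0.
pose C := Num.max 1 ((1 + e^-1) `^ p).
have C1 : 1 <= C by rewrite le_max lexx.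
have C2 : (1 + e^-1) `^ p <= C by rewrite le_max lexx orbT.
exists C; split => // u v u0 v0; have up := powR_ge0 u p; have vp := powR_ge0 v p.
have [vu|uv] := leP v (e * u).
  apply: (@le_trans _ _ (((1 + e) * u) `^ p)).
    by apply: ge0_ler_powR; rewrite ?nnegrE; nra.
  rewrite powRM ?e1p//; nra.
apply: (@le_trans _ _ (((1 + e^-1) * v) `^ p)).
  apply: ge0_ler_powR; rewrite ?nnegrE; [lra|nra|nra|].
  rewrite mulrDl mul1r addrC lerD2l -(ler_pM2l e0) mulrA divff ?gt_eqF//.
  by rewrite mul1r ltW.
rewrite powRM//; nra.
Qed.

(** Convexity at the midpoint. The factor [2^(r - 1)] is the one built into [pen_p]. *)
Lemma powR_convex2 (R : realType) (r x y : R) : 1 <= r -> 0 <= x -> 0 <= y ->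
  (x + y) `^ r <= 2 `^ (r - 1) * (x `^ r + y `^ r).
Proof.
move=> r1 x0 y0.
have h0 : (0 : R) <= 2^-1 by rewrite invr_ge0.
have h1 : (2^-1 : R) <= 1 by lra.
have half (a b : R) : conv (Itv01 h0 h1) (a : R^o) (b : R^o) = 2^-1 * (a + b).
  by rewrite convRE/= /unstable.onem; field.
have h : (2^-1 * (x + y)) `^ r <= 2^-1 * (x `^ r + y `^ r).
  by rewrite -!half; apply: (convex_powR r1); rewrite inE /= in_itv/= andbT.
have {1}-> : x + y = 2 * (2^-1 * (x + y)) by rewrite mulrA divff// mul1r.
rewrite powRM ?mulr_ge0 ?addr_ge0// -(mulr_powRB1 (x := 2) (p := r))//; last by lra.
rewrite [2 * _]mulrC -mulrA ler_wpM2l ?powR_ge0//; lra.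
Qed.

(** * Moments of the noise *)

Lemma integral_noise_norm (R : realType) (d : measure_display)
    (T : measurableType d) (P : probability T R) (I : choiceType)
    (xi : I -> {RV P >-> R}) (u s : R) (i : I) :
  0 < u -> noise_norm xi u s ->
  (\int[P]_o (`|xi i o| `^ u)%:E = (s `^ u)%:E)%E.
Proof.
by move=> u0 /(_ i) h; rewrite -poweR_EFin -h powR_Lnorm ?gt_eqF.
Qed.

Lemma measurable_abs_powR (R : realType) (d : measure_display)
    (T : measurableType d) (X : T -> R) (u : R) :
  measurable_fun [set: T] X -> measurable_fun [set: T] (fun o => `|X o| `^ u).
Proof.
move=> mX; apply: (measurableT_comp (measurable_powR _)).
exact: measurableT_comp.
Qed.

(** At [t = sqrt (2 k)] the subgaussian tail is [2 exp (- k)], so [X^2 / 2] has an exponential tail,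
    and its moment of order [r / 2] gives the bound. *)
Lemma subgaussian_moment (R : realType) (r : R) : 0 < r ->
  exists C : R, 0 <= C /\
  forall (d : measure_display) (T : measurableType d) (P : probability T R)
    (X : {RV P >-> R}),
  (forall t : R, 0 <= t ->
    (P [set o | (t <= `|X o|)%R] <= (2 * expR (- (t ^+ 2 / 2)))%:E)%E) ->
  mean_le P (fun o => `|X o| `^ r) C.
Proof.
move=> r0; have r2 : 0 < r / 2 by rewrite divr_gt0.
have [C [C0 hC]] := moment_of_tail r2.
exists (2 `^ (r / 2) * (2 * C)); split; first by rewrite !mulr_ge0 ?powR_ge0.
move=> d T P X tail.
have mX : measurable_fun [set: T] X by exact: measurable_funPT.
have mV : measurable_fun [set: T] (fun o => X o ^+ 2 / 2).
  by apply: measurable_funM => //; apply: measurable_funX.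
have V0 o : 0 <= X o ^+ 2 / 2 by rewrite divr_ge0// sqr_ge0.
have -> : (fun o => `|X o| `^ r) =
    (fun o => 2 `^ (r / 2) * (X o ^+ 2 / 2) `^ (r / 2)).
  apply/funext => o; rewrite -powRM// mulrC divfK//.
  rewrite -real_normK ?num_real// -powR_mulrn// -powRrM; congr (_ `^ _).
  by field.
apply: mean_leZ; first exact: powR_ge0.
apply: hC => // k.
rewrite [X in expR (- X)](_ : _ = Num.sqrt (2 * k%:R) ^+ 2 / 2); last first.
  by rewrite sqr_sqrtr// mulrC mulKf.
apply: le_trans (tail _ (sqrtr_ge0 _)); apply: le_measure.
- by rewrite inE; exact: measurable_gt_set.
- by rewrite inE; apply: measurable_ge_set; exact: measurableT_comp.
move=> o /=; rewrite ltr_pdivlMr// => kX.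
by rewrite -sqrtr_sqr ler_sqrt ?sqr_ge0// mulrC ltW.
Qed.

(* [kappa_2] blows up as [sigma_2] tends to 0, whereas the final constant may
   depend on the noise through [sigma_p] only.  The bound integrates
   [|y|^p <= K^(p-2) y^2 + K^(-p) |y|^(2p)] for a well-chosen [K]. *)
Lemma second_moment_lower_bound (R : realType) (p sp : R) : 2 <= p -> 0 < sp ->
  exists s : R, 0 < s /\
  forall (d : measure_display) (T : measurableType d) (P : probability T R)
    (I : choiceType) (xi : I -> {RV P >-> R}) (s2 : R) (i : I),
  iid_noise xi -> noise_norm xi p sp -> noise_norm xi 2 s2 ->
  s <= s2 `^ 2.
Proof.
move=> p2 sp0; have p20 : 0 < 2 * p by lra.
have p0 : 0 < p by lra.
have [C [C0 hC]] := subgaussian_moment p20.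
have spp : 0 < sp `^ p by exact: powR_gt0.
(* With [K^p = L] the moment of order [2p] contributes at most [C / L <= sp^p / 2], leaving half of
   [sp^p] to the second moment. The [+ 1] keeps [L] positive even if [C = 0]. *)
pose L : R := 2 * (C + 1) / sp `^ p.
have L0 : 0 < L by rewrite /L divr_gt0//; lra.
pose K : R := L `^ p^-1.
have K0 : 0 < K by exact: powR_gt0.
have Kp : K `^ p = L by rewrite /K -powRrM mulVf ?gt_eqF// powRr1// ltW.
have Kp2 : 0 < K `^ (p - 2) by exact: powR_gt0.
exists (sp `^ p / 2 / K `^ (p - 2)); split; first by rewrite !divr_gt0.
move=> d T P I xi s2 i [_ _ tail] np n2.
have mxi : measurable_fun [set: T] (xi i) by exact: measurable_funPT.
have h2 : mean_le P (fun o => `|xi i o| `^ 2) (s2 `^ 2).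
  split; first exact: measurable_abs_powR.
    by move=> o; exact: powR_ge0.
  by rewrite (integral_noise_norm _ _ n2).
have L1 : 0 < L^-1 by rewrite invr_gt0.
have mp : measurable_fun [set: T] (fun o => `|xi i o| `^ p).
  exact: measurable_abs_powR.
have key o : `|xi i o| `^ p <=
    K `^ (p - 2) * `|xi i o| `^ 2 + L^-1 * `|xi i o| `^ (2 * p).
  have [x0|x0] := eqVneq `|xi i o| 0.
    rewrite x0 [X in X <= _]powR0 ?gt_eqF//.
    by rewrite addr_ge0// mulr_ge0 ?powR_ge0// ltW.
  have {}x0 : 0 < `|xi i o| by rewrite lt_neqAle eq_sym x0 normr_ge0.
  have [xK|Kx] := leP `|xi i o| K.
    apply: (@le_trans _ _ (K `^ (p - 2) * `|xi i o| `^ 2)); last first.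
      by rewrite lerDl mulr_ge0 ?powR_ge0// ltW.
    rewrite [X in _ `^ X <= _](_ : p = (p - 2) + 2); last by rewrite subrK.
    rewrite powRD; last by rewrite (gt_eqF x0) implybT.
    rewrite ler_wpM2r ?powR_ge0//; apply: ge0_ler_powR; rewrite ?nnegrE//; lra.
  apply: (@le_trans _ _ (L^-1 * `|xi i o| `^ (2 * p))); last first.
    by rewrite lerDr mulr_ge0 ?powR_ge0// ltW.
  rewrite mulrDl mul1r powRD; last by rewrite (gt_eqF x0) implybT.
  rewrite mulrA ler_peMl ?powR_ge0// mulrC ler_pdivlMr// mul1r -Kp.
  apply: ge0_ler_powR; rewrite ?nnegrE//; lra.
have [_ _] := mean_le_le (mean_leD (mean_leZ (ltW Kp2) h2)
  (mean_leZ (ltW L1) (hC _ _ _ _ (tail i)))) mp (fun o => powR_ge0 _ _) key.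
rewrite (integral_noise_norm _ _ np)// lee_fin => h.
have LC : L^-1 * C <= sp `^ p / 2.
  have -> : L^-1 * C = sp `^ p / 2 * (C / (C + 1)).
    by rewrite /L; field; rewrite gt_eqF//=; lra.
  by rewrite ler_piMr ?divr_ge0 ?ltW// ltr_pdivrMr; lra.
rewrite ler_pdivrMr// mulrC; lra.
Qed.

(** * Deviation of block sums from the penalties *)

(** The deviation inequality concerns families indexed by a finite type; this allows a block to
    serve as such an index type. *)
Lemma iid_noise_fset (R : realType) (d : measure_display)
    (T : measurableType d) (P : probability T R) (I : choiceType)
    (xi : I -> {RV P >-> R}) (m : {fset I}) :
  iid_noise xi -> iid_noise (fun i : m => xi (val i)).
Proof.
move=> [[indep ident] centered tail]; split.
- split; last by move=> i j; exact: ident.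
  move=> F A mA; pose A' (l : I) : set R := if insub l is Some i then A i else setT.
  have A'E (i : m) : A' (val i) = A i by rewrite /A' valK.
  pose F' : {fset I} := [fset val i | i in F]%fset.
  have := indep F' A'.
  rewrite big_imfset /=; last by move=> i j _ _; exact: val_inj.
  under eq_bigr do rewrite A'E.
  move=> <-.
    congr (P _); apply/seteqP; split => o h l /=.
      by move=> /imfsetP[i /= iF ->]; rewrite A'E; exact: h.
    move=> lF; rewrite -A'E; apply: h => /=.
    by apply/imfsetP; exists l.
  by move=> l /imfsetP[i /= iF ->]; rewrite A'E; exact: mA.
- by move=> i; exact: centered.
- by move=> i; exact: tail.
Qed.

Lemma kappa_gt0 (R : realType) (c1 c2 sigma : R -> R) (u : R) :
  0 < c1 u -> 0 < c2 u -> 0 < kappa c1 c2 sigma u.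
Proof.
move=> c1u c2u; rewrite /kappa ltr_wpDr// mulr_ge0 ?(ltW c1u)//.
by rewrite le_max ler01.
Qed.

Lemma pen_p_ge0 (R : realType) (Lam : choiceType) (p : R) (c1 c2 sigma : R -> R)
    (x : R) (mj : {fset Lam}) : 0 < c1 p -> 0 < c2 p ->
  0 <= pen_p p c1 c2 sigma x mj.
Proof.
move=> c1p c2p; have k0 := ltW (kappa_gt0 sigma c1p c2p).
by rewrite /pen_p addr_ge0 ?mulr_ge0 ?powR_ge0// ?divr_ge0.
Qed.

(** Lets one excess bound, stated for a general exponent [u], cover both penalties. *)
Lemma pen_p2 (R : realType) (Lam : choiceType) (c1 c2 sigma : R -> R)
    (x : R) (mj : {fset Lam}) : 0 <= x -> 0 <= sigma 2 ->
  pen_p 2 c1 c2 sigma x mj = pen_sharp c1 c2 sigma x mj.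
Proof.
move=> x0 s0; rewrite /pen_p /pen_sharp divff// subrr powRr0 mulr1 powRr1//.
by rewrite powR_mulrn.
Qed.

(* AM-GM: [c1 sqrt (D x) <= sigma^u D / 2 + c1^2 x / (2 sigma^u)] *)
Lemma deviation_threshold_le (R : realType) (u s c1 c2 D x : R) : 2 <= u ->
  0 < s -> 0 < c1 -> 0 < c2 -> 0 <= D -> 1 <= x ->
  c1 * Num.sqrt (D * x) + c2 * D `^ Num.max (1 - u / 2) 0 * x `^ (u / 2)
  <= 1 / 2 * s * D + (c2 + c1 * Num.max 1 (c1 / (2 * s))) * x `^ (u / 2).
Proof.
move=> u2 s0 c10 c20 D0 x1.
rewrite (_ : Num.max _ _ = 0); last by apply/max_idPr; lra.
rewrite powRr0 mulr1.
have xu : x <= x `^ (u / 2) by rewrite le1r_powR//; lra.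
have : c1 * Num.sqrt (D * x) <= 1 / 2 * s * D + c1 * (c1 / (2 * s)) * x.
  have Dx0 : 0 <= D * x by rewrite mulr_ge0//; lra.
  rewrite -(ler_pM2l (mulr_gt0 (ltr0n R 2) s0)).
  have -> : 2 * s * (1 / 2 * s * D + c1 * (c1 / (2 * s)) * x) =
    s ^+ 2 * D + c1 ^+ 2 * x by field; rewrite gt_eqF.
  rewrite sqrtrM//.
  rewrite -{2}(sqr_sqrtr D0) -{2}(@sqr_sqrtr _ x); last by lra.
  by have := sqr_ge0 (s * Num.sqrt D - c1 * Num.sqrt x); rewrite !expr2; nra.
move=> h; rewrite mulrDl [leRHS]addrCA [leLHS]addrC lerD2l (le_trans h)// lerD2l.
have : 0 < c1 / (2 * s) by rewrite divr_gt0// mulr_gt0.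
move: (c1 / (2 * s)) => a a0; rewrite -!mulrA ler_pM2l//.
apply: (@le_trans _ _ (a * x `^ (u / 2))); first by rewrite ler_pM2l.
by rewrite ler_wpM2r ?powR_ge0// le_max lexx orbT.
Qed.

(** Apply the deviation inequality at level [x + n] for every [n]. Convexity splits [(x + n)^(u/2)]:
    the part in [x] is already in the penalty, and the part in [n] gives the excess a tail
    [2 exp (- x) exp (- n)], to be integrated. The noise level enters only through [kappa]. *)
Lemma mean_le_excess (R : realType) (u : R) (c1 c2 : R -> R) : 2 <= u ->
  deviation_constants u (c1 u) (c2 u) ->
  exists C : R, 0 <= C /\
  forall (d : measure_display) (T : measurableType d) (P : probability T R)
    (I : choiceType) (xi : I -> {RV P >-> R}) (sigma : R -> R) (m : {fset I})
    (x : R),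
  iid_noise xi -> noise_norm xi u (sigma u) -> 0 < sigma u -> 1 <= x ->
  mean_le P (fun o => Num.max 0 (\sum_(l <- m) `|xi l o| `^ u
                                 - pen_p u c1 c2 sigma x m))
    (kappa c1 c2 sigma u * C * expR (- x)).
Proof.
move=> u2 [c10 c20 dev]; have u20 : 0 < u / 2 by lra.
have [C [C0 hC]] := moment_of_tail u20.
exists (2 `^ (u / 2 - 1) * (2 * C)); split; first by rewrite !mulr_ge0 ?powR_ge0.
move=> d T P I xi sigma m x noise norm s0 x1.
set k := kappa _ _ _ _; have k0 : 0 < k by exact: kappa_gt0.
pose c := k * 2 `^ (u / 2 - 1).
have c0 : 0 < c by rewrite mulr_gt0// powR_gt0.
set S := fun o => \sum_(l <- m) `|xi l o| `^ u.
have mS : measurable_fun [set: T] S.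
  apply: measurable_sum => l; apply: measurable_abs_powR.
  exact: measurable_funPT.
set p0 := pen_p _ _ _ _ _ _.
pose Z o := Num.max 0 (S o - p0).
have mZ : measurable_fun [set: T] Z.
  by apply: measurable_maxr => //; apply: measurable_funB.
have Z0 o : 0 <= Z o by rewrite le_max lexx.
(* Rescaled so that [n < V] means [c * n^(u/2) < Z], the excess beyond the penalty that the
   deviation at [x + n] controls. *)
pose V o := (Z o / c) `^ (u / 2)^-1.
have mV : measurable_fun [set: T] V.
  apply: (measurableT_comp (measurable_powR _)).
  exact: measurable_funM.
have VE o : V o `^ (u / 2) = Z o / c.
  by rewrite -powRrM mulVf ?gt_eqF// powRr1// divr_ge0// ltW.
have -> : (fun o => Num.max 0 (S o - p0)) = (fun o => c * V o `^ (u / 2)).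
  by apply/funext => o; rewrite VE mulrC divfK// gt_eqF.
have -> : k * (2 `^ (u / 2 - 1) * (2 * C)) * expR (- x) = c * (2 * expR (- x) * C).
  by rewrite /c; ring.
apply: mean_leZ; first exact: ltW.
apply: hC => // [y|n]; first exact: powR_ge0.
have xn1 : 1 <= x + n%:R by rewrite (le_trans x1)// lerDl.
have := dev d T P m (fun i : m => xi (val i)) (sigma u) (x + n%:R)
  (iid_noise_fset m noise) (fun i => norm (val i)).
rewrite -mulrA -expRD -opprD => /(_ (lt_le_trans ltr01 xn1)) /=.
apply: le_trans; apply: le_measure.
- by rewrite inE; exact: measurable_gt_set.
- rewrite inE; apply: measurable_ge_set; apply: measurableT_comp => //.
  apply: measurable_funB => //; apply: measurable_sum => l.
  by apply: measurable_abs_powR; exact: measurable_funPT.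
move=> o /= nV.
have <- : S o = \sum_(i : m) `|xi (val i) o| `^ u by rewrite /S big_seq_fsetE.
rewrite -cardfE.
set D : R := #|` m|%:R.
apply: le_trans (ler_norm _).
apply: le_trans (deviation_threshold_le u2 (powR_gt0 u s0) c10 c20 (ler0n _ _) xn1) _.
rewrite -/(kappa c1 c2 sigma u) -/k.
have nZ : c * n%:R `^ (u / 2) < Z o.
  rewrite mulrC -ltr_pdivlMr// -VE; apply: gt0_ltr_powR => //.
    by rewrite nnegrE.
  by rewrite nnegrE; exact: powR_ge0.
have {}nZ : c * n%:R `^ (u / 2) < S o - p0.
  have cn0 : 0 <= c * n%:R `^ (u / 2) by rewrite mulr_ge0 ?powR_ge0// ltW.
  by move: nZ; rewrite /Z lt_max => /orP[/(le_lt_trans cn0)|//]; rewrite ltxx.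
have := powR_convex2 (_ : 1 <= u / 2) (_ : 0 <= x) (ler0n R n).
move=> /(_ ltac:(lra) ltac:(lra)) /(ler_wpM2l (ltW k0)).
rewrite mulrA -/c mulrDr.
move: nZ; rewrite /p0 /pen_p -/k -/c -/D.
lra.
Qed.

(** * Deterministic comparison of two models *)

Lemma big_fset_sub (R : nmodType) (I : choiceType) (m A : {fset I})
    (F : I -> R) : (m `<=` A)%fset ->
  \sum_(l <- m) F l = \sum_(l <- A) (if l \in m then F l else 0).
Proof.
move=> mA; rewrite -big_mkcond -[RHS]big_filter; apply: perm_big.
apply: uniq_perm => [||l]; rewrite ?filter_uniq ?fset_uniq//.
rewrite mem_filter; case: (boolP (l \in m)) => //= lm.
by rewrite (fsubsetP mA).
Qed.

(** [b] and [bh] tell whether the competitor and the selected model keep the coordinate. If only the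
    latter does, twice [|t + e|^p <= 3/2 |e|^p + C |t|^p] costs [3 |e|^p], and the loss itself one
    more: this is the factor 4. If only the competitor does, the same inequality bounds [|t|^p]
    through [t = (t + e) - e]. *)
Lemma coordinate_loss_le (R : realType) (p C t e : R) (b bh : bool) :
  0 < p -> 1 <= C ->
  (forall u v : R, 0 <= u -> 0 <= v ->
    (u + v) `^ p <= 3 / 2 * u `^ p + C * v `^ p) ->
  `|(if bh then t + e else 0) - t| `^ p <=
  2 * C * `|(if b then t + e else 0) - t| `^ p
  + (if bh then 4 * `|e| `^ p else 0)
  + 2 * ((if b then `|t + e| `^ p else 0) - (if bh then `|t + e| `^ p else 0)).
Proof.
move=> p0 C1 hC.
have ep := powR_ge0 `|e| p; have tp := powR_ge0 `|t| p.
have yp := powR_ge0 `|t + e| p.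
have te : t + e - t = e by ring.
case: b; case: bh; rewrite ?te ?sub0r ?normrN.
- nra.
- have : `|t| `^ p <= (`|t + e| + `|e|) `^ p.
    apply: ge0_ler_powR; rewrite ?nnegrE ?addr_ge0//; first exact: ltW.
    by rewrite -[X in `|X| <= _](addrK e) ler_normB.
  have := hC _ _ (normr_ge0 (t + e)) (normr_ge0 e); nra.
- have : `|t + e| `^ p <= (`|e| + `|t|) `^ p.
    apply: ge0_ler_powR; rewrite ?nnegrE ?addr_ge0//; first exact: ltW.
    by rewrite [leRHS]addrC ler_normD.
  have := hC _ _ (normr_ge0 e) (normr_ge0 t); nra.
- nra.
Qed.

(** After summation over coordinates, minimality bounds the difference of the sums of [w |y|^p] over
    [m] and [mh] by [penal m - penal mh]. *)
Lemma pco_loss_le (R : realType) (Lam : choiceType) (w : Lam -> R) (p C : R)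
    (penal : {fset Lam} -> R) (theta e : Lam -> R) (A m mh : {fset Lam}) :
  let y l := theta l + e l in
  let loss m := \sum_(l <- A) w l * `|estimator y m l - theta l| `^ p in
  0 < p -> 1 <= C ->
  (forall u v : R, 0 <= u -> 0 <= v ->
    (u + v) `^ p <= 3 / 2 * u `^ p + C * v `^ p) ->
  (forall l, 0 <= w l) -> (m `<=` A)%fset -> (mh `<=` A)%fset ->
  pco_criterion w p penal y mh <= pco_criterion w p penal y m ->
  loss mh <= 2 * C * loss m + 2 * penal m
             + 4 * (\sum_(l <- mh) w l * `|e l| `^ p - penal mh / 2).
Proof.
move=> y loss p0 C1 hC w0 mA mhA; rewrite /pco_criterion => crit.
suff : loss mh <= 2 * C * loss m + 4 * (\sum_(l <- mh) w l * `|e l| `^ p)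
    + 2 * (\sum_(l <- m) w l * `|y l| `^ p - \sum_(l <- mh) w l * `|y l| `^ p).
  lra.
rewrite (big_fset_sub _ mA) !(big_fset_sub _ mhA) /loss.
rewrite -sumrB !mulr_sumr -!big_split/=; apply: ler_sum => l _.
have := ler_wpM2l (w0 l)
  (coordinate_loss_le (theta l) (e l) (l \in m) (l \in mh) p0 C1 hC).
rewrite /estimator /y => /le_trans; apply; rewrite le_eqVlt; apply/orP; left.
by apply/eqP; case: (l \in m); case: (l \in mh); ring.
Qed.

(** Exchange the sums: each coordinate lies in some block, whose term alone yields [w l * F l], and
    the other terms are nonnegative. *)
Lemma level_sum_le (R : realType) (Lam : choiceType) (w : Lam -> R)
    (A : {fset Lam}) (J : finType) (LamJ : J -> {fset Lam}) (omega : J -> R)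
    (F : Lam -> R) (m : {fset Lam}) :
  level_partition w A LamJ omega -> (forall l, 0 <= w l) ->
  (forall l, 0 <= F l) -> (m `<=` A)%fset ->
  \sum_(l <- m) w l * F l
  <= \sum_(j : J) omega j * \sum_(l <- trace (LamJ j) m) F l.
Proof.
move=> [cover _ level _] w0 F0 mA.
have -> : \sum_(j : J) omega j * \sum_(l <- trace (LamJ j) m) F l =
    \sum_(l <- m) \sum_(j : J) (if l \in LamJ j then w l * F l else 0).
  rewrite exchange_big/=; apply: eq_bigr => j _.
  rewrite (big_fset_sub _ (fsubsetIl m (LamJ j))) mulr_sumr.
  apply: eq_big_seq => l lm; rewrite in_fsetI lm/=.
  by case: ifPn => [/level ->//|_]; rewrite mulr0.
rewrite big_seq [leRHS]big_seq; apply: ler_sum => l lm.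
have [j lj] := (cover l).1 (fsubsetP mA l lm).
rewrite (bigD1 j)//= lj lerDl; apply: sumr_ge0 => i _.
by case: ifP => // _; rewrite mulr_ge0.
Qed.

Lemma level_weight_ge0 (R : realType) (Lam : choiceType) (w : Lam -> R)
    (A : {fset Lam}) (J : finType) (LamJ : J -> {fset Lam}) (omega : J -> R)
    (j : J) :
  level_partition w A LamJ omega -> (forall l, 0 <= w l) -> 0 <= omega j.
Proof.
move=> [_ nonempty level _] w0.
by have /fset0Pn[l lj] := nonempty j; rewrite -(level j l lj).
Qed.

(** For models inside [A] the estimators vanish off [A], so the second part of the loss is a
    constant common to all of them. *)
Lemma wnorm_pow_split (R : realType) (Lam : choiceType) (w : Lam -> R) (p : R)
    (v : Lam -> R) (A : {fset Lam}) : (forall l, 0 <= w l) ->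
  wnorm_pow w p v = ((\sum_(l <- A) w l * `|v l| `^ p)%:E
    + \esum_(l in ~` [set` A]) (w l * `|v l| `^ p)%:E)%E.
Proof.
move=> w0; rewrite /wnorm_pow (esumID [set` A]); last first.
  by move=> l _; rewrite lee_fin mulr_ge0 ?powR_ge0.
rewrite !setTI esum_fset; last 2 first.
- exact: finite_fset.
- by move=> l _; rewrite lee_fin mulr_ge0 ?powR_ge0.
by rewrite fsbig_finite ?set_fsetK ?sumEFin//; exact: finite_fset.
Qed.

(** * Pathwise oracle inequality with an explicit remainder *)

Lemma sum_powR_truncated_le (R : realType) (I : choiceType) (f : I -> R)
    (m : {fset I}) (p t : R) : 2 <= p -> 0 <= t ->
  (forall l, l \in m -> `|f l| < Num.sqrt t) ->
  \sum_(l <- m) `|f l| `^ p <= t `^ (p / 2 - 1) * \sum_(l <- m) `|f l| `^ 2.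
Proof.
move=> p2 t0 ft; rewrite mulr_sumr big_seq [leRHS]big_seq.
apply: ler_sum => l /ft flt.
have [->|f0] := eqVneq (f l) 0.
  by rewrite normr0 !powR0 ?mulr0//; apply/eqP; lra.
have -> : `|f l| `^ p = (`|f l| `^ 2) `^ (p / 2 - 1) * `|f l| `^ 2.
  rewrite -powRrM -powRD; last by rewrite normr_eq0 f0 implybT.
  by congr (_ `^ _); field.
rewrite ler_wpM2r ?powR_ge0//.
apply: ge0_ler_powR; rewrite ?nnegrE ?powR_ge0//; first by lra.
by rewrite powR_mulrn// -(sqr_sqrtr t0) lerXn2r ?nnegrE ?sqrtr_ge0// ltW.
Qed.

(* The remainder of the oracle inequality as a function of the noise [f]: the
   excess of the block sums over both penalties, and what is lost when some
   coordinate of the noise exceeds [sqrt L]; [a] balances the latter terms. *)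
Definition pco_remainder (R : realType) (Lam : choiceType) (w : Lam -> R)
    (J : finType) (LamJ : J -> {fset Lam}) (omega : J -> R)
    (x : J -> {fset Lam} -> R) (M : {fset {fset Lam}}) (A : {fset Lam})
    (c1 c2 sigma : R -> R) (p eps L c a Th : R) (f : Lam -> R) : R :=
  let excess u j (mj : {fset Lam}) :=
    Num.max 0 (\sum_(l <- mj) `|f l| `^ u - pen_p u c1 c2 sigma (x j mj) mj) in
  let U := \sum_(l <- A) (Num.sqrt L <= `|f l|)%R%:R in
  4 * eps `^ p * (\sum_(j : J) omega j *
    \sum_(mj <- traces (LamJ j) M | mj != fset0)
      (c * excess p j mj + L `^ (p / 2 - 1) * excess 2 j mj))
  + (Th * U + eps `^ p * \sum_(l <- A) w l *
      (a / 2 * `|f l| `^ (2 * p) + (2 * a)^-1 * U)).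

Lemma le_minr_excess (R : realType) (S S2 p1 p2 c k : R) :
  1 <= c -> 0 <= k -> S <= k * S2 ->
  S - Num.min p1 (k * p2) <= c * Num.max 0 (S - p1) + k * Num.max 0 (S2 - p2).
Proof.
move=> c1 k0 Sk.
have m1 : S - p1 <= Num.max 0 (S - p1) by rewrite le_max lexx orbT.
have m10 : 0 <= Num.max 0 (S - p1) by rewrite le_max lexx.
have m2 : S2 - p2 <= Num.max 0 (S2 - p2) by rewrite le_max lexx orbT.
have m20 : 0 <= Num.max 0 (S2 - p2) by rewrite le_max lexx.
by rewrite minEle; case: ifPn => _; nra.
Qed.

(** In use the block comes from the selected, hence random, model. Its excess is charged to the sum
    over all nonempty members of [S], whose terms are deterministic in their index; an empty block
    has no excess. *)
Lemma block_excess_le (R : realType) (Lam : choiceType) (p : R)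
    (c1 c2 sigma : R -> R) (L c : R) (f : Lam -> R) (S : {fset {fset Lam}})
    (x : {fset Lam} -> R) (m : {fset Lam}) :
  2 <= p -> 0 <= L -> 1 <= c -> 0 < c1 p -> 0 < c2 p -> 0 < c1 2 -> 0 < c2 2 ->
  0 <= sigma 2 ->
  (forall l, l \in m -> `|f l| < Num.sqrt L) -> m \in S -> 1 <= x m ->
  \sum_(l <- m) `|f l| `^ p
    - Num.min (pen_p p c1 c2 sigma (x m) m)
        (L `^ (p / 2 - 1) * pen_sharp c1 c2 sigma (x m) m)
  <= \sum_(mj <- S | mj != fset0)
       (c * Num.max 0 (\sum_(l <- mj) `|f l| `^ p
                       - pen_p p c1 c2 sigma (x mj) mj)
        + L `^ (p / 2 - 1) * Num.max 0 (\sum_(l <- mj) `|f l| `^ 2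
                                        - pen_p 2 c1 c2 sigma (x mj) mj)).
Proof.
move=> p2 L0 c1' c1p c2p c12 c22 s2 fL mS xm.
have Lp : 0 <= L `^ (p / 2 - 1) by exact: powR_ge0.
have x0 : 0 <= x m by lra.
have terms_ge0 (mj : {fset Lam}) : 0 <=
    c * Num.max 0 (\sum_(l <- mj) `|f l| `^ p - pen_p p c1 c2 sigma (x mj) mj)
    + L `^ (p / 2 - 1) * Num.max 0 (\sum_(l <- mj) `|f l| `^ 2
                                    - pen_p 2 c1 c2 sigma (x mj) mj).
  by rewrite addr_ge0 ?mulr_ge0 ?le_max ?lexx//; lra.
have [m0|m0] := eqVneq m fset0.
  apply: (@le_trans _ _ 0); last by apply: sumr_ge0 => mj _; exact: terms_ge0.
  rewrite {1}m0 big_seq_fset0 sub0r oppr_le0 le_min pen_p_ge0//=.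
  by rewrite mulr_ge0// -pen_p2// pen_p_ge0.
rewrite (big_rem m)//= m0.
apply: ler_wpDr; first by apply: sumr_ge0 => mj _; exact: terms_ge0.
rewrite -pen_p2//; apply: le_minr_excess => //.
exact: sum_powR_truncated_le.
Qed.

(** Weighted AM-GM, the gap being [(a z - 1)^2 / (2 a)]. In use [U] counts the large noise
    coordinates, so no mean of a product is needed. *)
Lemma powR_abs_split (R : realType) (p a y U : R) : 0 < a -> 1 <= U ->
  `|y| `^ p <= a / 2 * `|y| `^ (2 * p) + (2 * a)^-1 * U.
Proof.
move=> a0 U1.
have -> : `|y| `^ (2 * p) = (`|y| `^ p) ^+ 2.
  by rewrite mulrC powRrM powR_mulrn ?powR_ge0.
set z := `|y| `^ p.
have i0 : 0 < (2 * a)^-1 by rewrite invr_gt0 mulr_gt0.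
apply: (@le_trans _ _ (a / 2 * z ^+ 2 + (2 * a)^-1)); last first.
  by rewrite lerD2l ler_peMr// ltW.
have -> : a / 2 * z ^+ 2 + (2 * a)^-1 = z + (2 * a)^-1 * (a * z - 1) ^+ 2.
  by field; rewrite gt_eqF.
by rewrite lerDl mulr_ge0 ?sqr_ge0// ltW.
Qed.

Lemma pen_ge0 (R : realType) (Lam : choiceType) (J : finType)
    (LamJ : J -> {fset Lam}) (omega : J -> R) (x : J -> {fset Lam} -> R)
    (M : {fset {fset Lam}}) (c1 c2 sigma : R -> R) (p q eps : R) (N : nat)
    (m : {fset Lam}) :
  0 < c1 p -> 0 < c2 p -> 0 < c1 2 -> 0 < c2 2 -> 0 <= sigma 2 ->
  (forall j, 0 <= omega j) ->
  (forall j mj, mj \in traces (LamJ j) M -> 1 <= x j mj) -> m \in M ->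
  0 <= pen LamJ omega x p q eps N c1 c2 sigma m.
Proof.
move=> c1p c2p c12 c22 s2 om0 x1 mM.
rewrite /pen mulr_ge0//; first by rewrite mulr_ge0 ?powR_ge0.
apply: sumr_ge0 => j _; rewrite mulr_ge0//= le_min pen_p_ge0//=.
have x0 : 0 <= x j (trace (LamJ j) m).
  by apply: le_trans (x1 j _ _) => //; apply/imfsetP; exists m.
by rewrite mulr_ge0 ?powR_ge0// -pen_p2 ?pen_p_ge0.
Qed.

Lemma pco_pointwise (R : realType) (Lam : choiceType) (w : Lam -> R)
    (J : finType) (LamJ : J -> {fset Lam}) (omega : J -> R)
    (x : J -> {fset Lam} -> R) (M : {fset {fset Lam}}) (A : {fset Lam})
    (c1 c2 sigma : R -> R) (p q eps C a b : R) (N : nat)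
    (theta f : Lam -> R) (m mh : {fset Lam}) :
  let y l := theta l + eps * f l in
  let loss m := \sum_(l <- A) w l * `|estimator y m l - theta l| `^ p in
  let penal := pen LamJ omega x p q eps N c1 c2 sigma in
  2 <= p -> 1 < q -> 1 <= C ->
  (forall u v : R, 0 <= u -> 0 <= v ->
    (u + v) `^ p <= 3 / 2 * u `^ p + C * v `^ p) ->
  0 < c1 p -> 0 < c2 p -> 0 < c1 2 -> 0 < c2 2 -> 0 < sigma 2 ->
  0 < eps -> 0 < a -> 0 <= b -> #|` A| = N -> (0 < N)%N ->
  (forall l, 0 <= w l) -> level_partition w A LamJ omega ->
  (forall m, m \in M -> (m `<=` A)%fset) ->
  (forall j mj, mj \in traces (LamJ j) M -> 1 <= x j mj) ->
  m \in M -> mh \in M ->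
  pco_criterion w p penal y mh <= pco_criterion w p penal y m ->
  loss mh + b <= 2 * C * (loss m + b) + 2 * penal m +
    pco_remainder w LamJ omega x M A c1 c2 sigma p eps (2 * q * ln N%:R)
      ((ln N%:R / ln 2) `^ (p / 2 - 1)) a
      (\sum_(l <- A) w l * `|theta l| `^ p + b) f.
Proof.
move=> y loss penal p2 q1 C1 hC c1p c2p c12 c22 s2 eps0 a0 b0 AN N0 w0 part
  MA x1 mM mhM crit.
have p0 : 0 < p by lra.
have lnN0 : 0 <= ln (N%:R : R) by rewrite ln_ge0// ler1n.
have L0 : 0 <= 2 * q * ln (N%:R : R) by rewrite mulr_ge0//; lra.
have tr j m' : m' \in M -> trace (LamJ j) m' \in traces (LamJ j) M.
  by move=> m'M; apply/imfsetP; exists m'.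
have om0 j : 0 <= omega j by exact: (level_weight_ge0 _ part).
have epsp : 0 < eps `^ p by exact: powR_gt0.
have loss0 m' : 0 <= loss m'.
  by apply: sumr_ge0 => l _; rewrite mulr_ge0 ?powR_ge0.
have pen0 m' : m' \in M -> 0 <= penal m'.
  by move=> m'M; apply: pen_ge0 x1 m'M => //; exact: ltW.
rewrite /pco_remainder.
set B := \sum_(j : J) _; set U := \sum_(l <- A) _.
set Th := \sum_(l <- A) w l * `|theta l| `^ p.
set V := \sum_(l <- A) _.
have U0 : 0 <= U by apply: sumr_ge0.
have Th0 : 0 <= Th by apply: sumr_ge0 => l _; rewrite mulr_ge0 ?powR_ge0.
have B0 : 0 <= B.
  apply: sumr_ge0 => j _; rewrite mulr_ge0//; apply: sumr_ge0 => mj _.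
  by rewrite addr_ge0 ?mulr_ge0 ?powR_ge0 ?le_max ?lexx.
have V0 : 0 <= V.
  apply: sumr_ge0 => l _; rewrite mulr_ge0// addr_ge0 ?mulr_ge0 ?powR_ge0//.
  - exact: ltW.
  - by rewrite invr_ge0 mulr_ge0// ltW.
have [small|] := boolP (all (fun l => `|f l| < Num.sqrt (2 * q * ln N%:R)) A).
  (* For [N = 1] the threshold is [0], which every coordinate reaches; hence this case forces
     [N >= 2]. *)
  have N2 : (1 < N)%N.
    rewrite ltn_neqAle N0 andbT; apply/eqP => N1.
    have /fset0Pn[l lA] : A != fset0 by rewrite -cardfs_gt0 AN.
    have := allP small l lA.
    by rewrite -N1 ln1 mulr0 sqrtr0 ltNge normr_ge0.
  have ln20 : 0 < ln (2 : R) by rewrite ln_gt0// ltr1n.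
  (* Dividing by [ln 2] makes the coefficient at least [1] once [N >= 2], while it stays a multiple
     of [(log N)^(p/2-1)], as the final remainder requires. *)
  have c1' : 1 <= (ln N%:R / ln 2) `^ (p / 2 - 1) :> R.
    rewrite -[leLHS](powRr0 (ln N%:R / ln 2)); apply: ler_powR; last by lra.
    by rewrite ler_pdivlMr// mul1r ler_ln ?posrE ?ltr0n// ler_nat.
  have := pco_loss_le p0 C1 hC w0 (MA m mM) (MA mh mhM) crit.
  rewrite -/(loss mh) -/(loss m).
  suff : \sum_(l <- mh) w l * `|eps * f l| `^ p - penal mh / 2 <= eps `^ p * B.
    have Cb : b <= 2 * C * b by rewrite ler_peMl//; lra.
    have r0 : 0 <= (Th + b) * U + eps `^ p * V.
      by apply: addr_ge0; rewrite mulr_ge0 ?addr_ge0// ltW.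
    lra.
  have -> : \sum_(l <- mh) w l * `|eps * f l| `^ p =
      eps `^ p * \sum_(l <- mh) w l * `|f l| `^ p.
    rewrite mulr_sumr; apply: eq_bigr => l _.
    by rewrite normrM powRM// (gtr0_norm eps0) mulrCA.
  have -> : penal mh / 2 = eps `^ p * (penal mh / (2 * eps `^ p)).
    by field; rewrite gt_eqF.
  rewrite -mulrBr ler_pM2l//.
  rewrite /penal /pen mulrC mulKf ?gt_eqF ?mulr_gt0//.
  apply: (@le_trans _ _ (\sum_(j : J) omega j *
      (\sum_(l <- trace (LamJ j) mh) `|f l| `^ p -
       Num.min (pen_p p c1 c2 sigma (x j (trace (LamJ j) mh)) (trace (LamJ j) mh))
         ((2 * q * ln N%:R) `^ (p / 2 - 1) *
          pen_sharp c1 c2 sigma (x j (trace (LamJ j) mh)) (trace (LamJ j) mh))))).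
    under [leRHS]eq_bigr do rewrite mulrBr.
    rewrite sumrB lerB//.
    by apply: level_sum_le part w0 _ (MA _ mhM) => l; exact: powR_ge0.
  apply: ler_sum => j _; rewrite ler_wpM2l//.
  apply: block_excess_le => //; [exact: ltW| |exact: tr|exact/x1/tr].
  move=> l; rewrite in_fsetI => /andP[lmh _].
  by apply: (allP small); exact: (fsubsetP (MA mh mhM)).
rewrite -has_predC => /hasP[l0 l0A /=]; rewrite -leNgt => fl0.
have U1 : 1 <= U.
  by rewrite /U (big_rem l0)//= fl0 lerDl; apply: sumr_ge0.
(* Exceptional event: a kept coordinate loses its noise and a dropped one its signal, so all the
   noise plus all the signal bounds the loss; [1 <= U] inserts the factor [U]. *)
apply: (@le_trans _ _ ((Th + b) * U + eps `^ p * V)); last first.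
  have h1 : 0 <= 2 * C * (loss m + b) by rewrite mulr_ge0 ?addr_ge0//; lra.
  have h2 : 0 <= 4 * eps `^ p * B by rewrite mulr_ge0// mulr_ge0// ltW.
  have := pen0 m mM; lra.
apply: (@le_trans _ _ (Th + b + eps `^ p * V)); last first.
  by rewrite lerD2r ler_peMr// addr_ge0.
rewrite addrAC lerD2r /loss /Th /V mulr_sumr -big_split/=.
apply: ler_sum => l _; rewrite mulrCA -mulrDr; apply: ler_wpM2l => //.
have tp := powR_ge0 `|theta l| p.
have split := ler_wpM2l (ltW epsp) (powR_abs_split p (f l) a0 U1).
rewrite /estimator /y; case: ifP => _.
  rewrite addrAC subrr add0r normrM powRM// (gtr0_norm eps0); lra.
rewrite sub0r normrN lerDl mulr_ge0 ?(ltW epsp)//.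
by apply: le_trans (powR_abs_split p (f l) a0 U1); exact: powR_ge0.
Qed.

(** * Mean of the remainder *)

Lemma mean_le_remainder (R : realType) (d : measure_display)
    (T : measurableType d) (P : probability T R) (Lam : choiceType)
    (xi : Lam -> {RV P >-> R}) (w : Lam -> R)
    (J : finType) (LamJ : J -> {fset Lam}) (omega : J -> R)
    (x : J -> {fset Lam} -> R) (M : {fset {fset Lam}}) (A : {fset Lam})
    (c1 c2 sigma : R -> R) (p eps L c a Th k1 k2 k4 u : R) :
  0 < eps -> 0 <= c -> 0 < a -> 0 <= Th -> (forall l, 0 <= w l) ->
  (forall j, 0 <= omega j) ->
  (forall j mj, mj \in traces (LamJ j) M ->
    mean_le P (fun o => Num.max 0 (\sum_(l <- mj) `|xi l o| `^ p
                                   - pen_p p c1 c2 sigma (x j mj) mj))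
      (k1 * expR (- x j mj))) ->
  (forall j mj, mj \in traces (LamJ j) M ->
    mean_le P (fun o => Num.max 0 (\sum_(l <- mj) `|xi l o| `^ 2
                                   - pen_p 2 c1 c2 sigma (x j mj) mj))
      (k2 * expR (- x j mj))) ->
  (forall l, mean_le P (fun o => `|xi l o| `^ (2 * p)) k4) ->
  (forall l, (P [set o | (Num.sqrt L <= `|xi l o|)%R] <= u%:E)%E) ->
  mean_le P (fun o => pco_remainder w LamJ omega x M A c1 c2 sigma p eps L c a Th
                        (fun l => xi l o))
    (4 * eps `^ p * ((c * k1 + L `^ (p / 2 - 1) * k2) * Rrem LamJ omega x M)
     + (Th * (#|` A|%:R * u) + eps `^ p * \sum_(l <- A) w l *
         (a / 2 * k4 + (2 * a)^-1 * (#|` A|%:R * u)))).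
Proof.
move=> eps0 c0 a0 Th0 w0 om0 exc1 exc2 mom large.
have epsp : 0 <= eps `^ p by exact: powR_ge0.
(* Union bound in additive form: [U] counts the large coordinates, so its mean is at most their
   number times the individual tail. *)
have mU : mean_le P (fun o => \sum_(l <- A) (Num.sqrt L <= `|xi l o|)%R%:R)
    (#|` A|%:R * u).
  rewrite (_ : _ * u = \sum_(l <- A) u); last first.
    by rewrite big_const_seq count_predT iter_addr_0 mulr_natl.
  apply: mean_le_sum => l _ _.
  rewrite (_ : (fun o => _) = \1_[set o | (Num.sqrt L <= `|xi l o|)%R]).
    apply: mean_le_indic => //; apply: measurable_ge_set.
    by apply: measurableT_comp => //; exact: measurable_funPT.
  apply/funext => y; rewrite indicE.
  rewrite (_ : (y \in _) = (Num.sqrt L <= `|xi l y|)%R)//.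
  by apply/idP/idP => [/set_mem//|?]; exact/mem_set.
apply: mean_leD.
  apply: mean_leZ; first by rewrite mulr_ge0.
  rewrite (_ : _ * Rrem _ _ _ _ = \sum_(j : J) omega j *
    \sum_(mj <- traces (LamJ j) M | mj != fset0)
      (c * (k1 * expR (- x j mj)) + L `^ (p / 2 - 1) * (k2 * expR (- x j mj)))).
    apply: mean_le_sum => j _ _; apply: mean_leZ => //.
    apply: mean_le_sum => mj mjM _.
    by apply: mean_leD; apply: mean_leZ; rewrite ?powR_ge0//; auto.
  rewrite /Rrem mulr_sumr; apply: eq_bigr => j _.
  rewrite mulrCA; congr (_ * _); rewrite mulr_sumr; apply: eq_bigr => mj _.
  by ring.
apply: mean_leD; first exact: mean_leZ.
apply: mean_leZ => //; apply: mean_le_sum => l _ _; apply: mean_leZ => //.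
apply: mean_leD; apply: mean_leZ => //; first by rewrite divr_ge0// ltW.
by rewrite invr_ge0 mulr_ge0// ltW.
Qed.

(** The value of [a] makes [n * 2 n^(-q) = 2 a^2], so both halves of the AM-GM split are of order
    [a], and the signal is multiplied by [2 a^2 = 2 n^(1-q)]. *)
Lemma remainder_bound_le (R : realType) (p q eps n lnn ln2 W Th S k1 k2 k2' k4 : R) :
  2 <= p -> 1 < q -> 0 < n -> 0 <= lnn -> 0 < ln2 -> 0 <= W -> 0 <= Th -> 0 <= S ->
  0 <= k1 -> k2 <= k2' -> 0 <= k2' -> 0 <= k4 ->
  forall a, a = n `^ ((1 - q) / 2) ->
  4 * eps `^ p * (((lnn / ln2) `^ (p / 2 - 1) * k1
                   + (2 * q * lnn) `^ (p / 2 - 1) * k2) * S)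
     + (Th * (n * (2 * n `^ (- q))) + eps `^ p * (W *
         (a / 2 * k4 + (2 * a)^-1 * (n * (2 * n `^ (- q))))))
  <= (4 * (ln2^-1 `^ (p / 2 - 1) * k1 + (2 * q) `^ (p / 2 - 1) * k2')
      + 2 + (k4 / 2 + 1))
     * (n `^ (1 - q) * Th + eps `^ p * (a * W + lnn `^ (p / 2 - 1) * S)).
Proof.
move=> p2 q1 n0 lnn0 ln20 W0 Th0 S0 k10 k22 k20 k40 a aE.
have a0 : 0 < a by rewrite aE powR_gt0.
have aa : n `^ (1 - q) = a ^+ 2.
  by rewrite aE -powR_mulrn ?powR_ge0// -powRrM; congr (_ `^ _); field.
have -> : n * (2 * n `^ (- q)) = 2 * a ^+ 2.
  rewrite -aa powRD; last by rewrite (gt_eqF n0) implybT.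
  by rewrite powRr1 ?ltW//; ring.
have q20 : 0 <= 2 * q by lra.
have iln0 : 0 <= ln2^-1 by rewrite invr_ge0 ltW.
rewrite aa (powRM _ q20 lnn0) (powRM _ lnn0 iln0).
set h := _ `^ (p / 2 - 1); set i := ln2^-1 `^ _; set r := (2 * q) `^ _.
have h0 : 0 <= h by exact: powR_ge0.
have i0 : 0 <= i by exact: powR_ge0.
have r0 : 0 <= r by exact: powR_ge0.
have e0 : 0 <= eps `^ p by exact: powR_ge0.
have -> : a / 2 * k4 + (2 * a)^-1 * (2 * a ^+ 2) = (k4 / 2 + 1) * a.
  by field; rewrite gt_eqF.
have rk : r * k2 <= r * k2' by rewrite ler_wpM2l.
have hS : 0 <= eps `^ p * (h * S) by rewrite !mulr_ge0.
have aT : 0 <= a ^+ 2 * Th by rewrite mulr_ge0 ?sqr_ge0.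
have aW : 0 <= eps `^ p * (a * W) by rewrite !mulr_ge0// ltW.
have B0 : 0 <= i * k1 + r * k2' by rewrite addr_ge0 ?mulr_ge0.
have := ler_wpM2r hS rk.
rewrite (_ : 4 * _ * _ = 4 * (i * k1 * (eps `^ p * (h * S))
  + r * k2 * (eps `^ p * (h * S)))); last by ring.
rewrite (_ : Th * _ = 2 * (a ^+ 2 * Th)); last by ring.
rewrite (_ : eps `^ p * (W * _) = (k4 / 2 + 1) * (eps `^ p * (a * W))); last by ring.
rewrite (mulrDr (eps `^ p)).
move: hS aT aW; set X := eps `^ p * (h * S); set Y := a ^+ 2 * Th.
set Z := eps `^ p * (a * W) => X0 Y0 Z0 rX.
have i1 : 0 <= i * k1 by rewrite mulr_ge0.
have i2 : 0 <= r * k2' by rewrite mulr_ge0.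
have BY : 0 <= (i * k1 + r * k2') * Y by rewrite mulr_ge0.
have BZ : 0 <= (i * k1 + r * k2') * Z by rewrite mulr_ge0.
have kX : 0 <= (k4 / 2 + 1) * X by rewrite mulr_ge0//; lra.
have kY : 0 <= (k4 / 2 + 1) * Y by rewrite mulr_ge0//; lra.
nra.
Qed.

(** The threshold is the level at which the subgaussian bound equals [2 N^(-q)]; over [N]
    coordinates this gives [2 N^(1-q)]. *)
Lemma noise_tail_log (R : realType) (d : measure_display) (T : measurableType d)
    (P : probability T R) (I : choiceType) (xi : I -> {RV P >-> R}) (q : R)
    (N : nat) (l : I) : 0 <= q -> (0 < N)%N -> iid_noise xi ->
  (P [set o | (Num.sqrt (2 * q * ln N%:R) <= `|xi l o|)%R]
   <= (2 * N%:R `^ (- q))%:E)%E.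
Proof.
move=> q0 N0 [_ _ tail]; apply: le_trans (tail l _ (sqrtr_ge0 _)) _.
have lnN0 : 0 <= ln (N%:R : R) by rewrite ln_ge0// ler1n.
rewrite sqr_sqrtr; last by rewrite !mulr_ge0.
rewrite lee_fin /powR pnatr_eq0 -[N == 0%N]negbK -lt0n N0/=.
rewrite le_eqVlt; apply/orP; left; apply/eqP; congr (2 * expR _).
by field.
Qed.

(** [kappa] is nonincreasing in the noise level, so a lower bound [s] on the moment bounds it
    uniformly. *)
Lemma kappa_le (R : realType) (c1 c2 sigma : R -> R) (u s : R) :
  0 < c1 u -> 0 < s -> s <= sigma u `^ u ->
  kappa c1 c2 sigma u <= c2 u + c1 u * Num.max 1 (c1 u / (2 * s)).
Proof.
move=> c1u s0 su; rewrite /kappa lerD2l ler_pM2l// ge_max le_max lexx/=.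
rewrite le_max; apply/orP; right; rewrite ler_pM2l// lef_pV2 ?posrE ?mulr_gt0//.
  by rewrite ler_pM2l.
exact: lt_le_trans su.
Qed.

(** * Measurability, and integration of the pathwise inequality *)

Lemma measurable_loss (R : realType) (d : measure_display)
    (T : measurableType d) (P : probability T R) (Lam : choiceType)
    (xi : Lam -> {RV P >-> R}) (w : Lam -> R) (p eps : R) (theta : Lam -> R)
    (A m : {fset Lam}) :
  measurable_fun [set: T] (fun o => \sum_(l <- A) w l *
    `|estimator (obs theta eps xi o) m l - theta l| `^ p).
Proof.
apply: measurable_sum => l; apply: measurable_funM => //.
apply: measurable_abs_powR; apply: measurable_funB => //.
rewrite /estimator /obs; case: (l \in m) => //.
by apply: measurable_funD => //; apply: measurable_funM.
Qed.

(** The collection is finite, so the function is a finite sum over the possible values of [mhat],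
    weighted by their indicators. *)
Lemma measurable_random_model (R : realType) (d : measure_display)
    (T : measurableType d) (Lam : choiceType) (M : {fset {fset Lam}})
    (mhat : T -> {fset Lam}) (g : {fset Lam} -> T -> R) :
  (forall m, measurable (mhat @^-1` [set m])) -> (forall o, mhat o \in M) ->
  (forall m, measurable_fun [set: T] (g m)) ->
  measurable_fun [set: T] (fun o => g (mhat o) o).
Proof.
move=> mmhat mhatM mg.
rewrite (_ : (fun o => _) =
  (fun o => \sum_(m <- M) \1_(mhat @^-1` [set m]) o * g m o)).
  by apply: measurable_sum => m; apply: measurable_funM.
apply/funext => y; rewrite (bigD1_seq (mhat y)) ?fset_uniq//= big1.
  by rewrite indicE mem_set// mul1r addr0.
move=> m my; rewrite indicE memNset ?mul0r// => /= E.
by rewrite E eqxx in my.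
Qed.

Theorem theorem2p7 (R : realType) (p : R) (hp : 2 <= p) (c1 c2 : R -> R)
    (hcp : deviation_constants p (c1 p) (c2 p))
    (hc2 : deviation_constants 2 (c1 2) (c2 2)) :
  exists Mt : R, forall (sigma_p q : R), 1 < q -> exists Mb : R,
  forall (d : measure_display) (T : measurableType d) (P : probability T R)
    (Lam : choiceType) (rk : Lam -> nat) (N : nat)
    (eps : R) (theta : Lam -> R) (xi : Lam -> {RV P >-> R}) (sigma : R -> R)
    (w : Lam -> R)
    (J : finType) (LamJ : J -> {fset Lam}) (omega : J -> R)
    (M : {fset {fset Lam}}) (x : J -> {fset Lam} -> R)
    (mhat : T -> {fset Lam}),
  let LamN := first_elements rk N in
  let Y := obs theta eps xi in
  let penal := pen LamJ omega x p q eps N c1 c2 sigma in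
  enumeration rk -> (0 < N)%N -> #|` LamN| = N ->
  0 < eps -> eps <= 1 ->
  iid_noise xi ->
  (forall u, 1 <= u -> noise_norm xi u (sigma u) /\ 0 < sigma u) ->
  sigma p = sigma_p ->
  (forall l, 0 <= w l) ->
  (wnorm_pow w p theta < +oo)%E ->
  level_partition w LamN LamJ omega ->
  M != fset0 ->
  (forall m, m \in M -> (m `<=` LamN)%fset) ->
  (forall j mj, mj \in traces (LamJ j) M -> 1 <= x j mj) ->
  pco_selector w p penal Y M mhat ->
  (risk P w p theta Y mhat
   <= Mt%:E * ereal_inf [set risk P w p theta Y (fun=> m) + (penal m)%:E
                        | m in [set` M]]
      + Mb%:E * ((N%:R `^ (1 - q))%:E * wnorm_pow w p theta
                 + (eps `^ p * Rrem_sharp LamJ omega x M w LamN p q N)%:E))%E.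
Proof.
have p0 : 0 < p by lra.
have p20 : 0 < 2 * p by lra.
have [c1p c2p _] := hcp; have [c12 c22 _] := hc2.
have [C [C1 hC]] := powR_add_le p0.
have [Cp [Cp0 excp]] := mean_le_excess hp hcp.
have [C2 [C20 exc2]] := mean_le_excess (lexx 2) hc2.
have [C4 [C40 mom]] := subgaussian_moment p20.
exists (2 * C) => sigma_p q q1.
(* A nonpositive [sigma_p] contradicts [0 < sigma p], so any constant serves. *)
have [sp0|sp0] := leP sigma_p 0.
  exists 0 => d T P Lam rk N eps theta xi sigma w J LamJ omega M x mhat.
  move=> LamN Y penal _ _ _ _ _ _ norm sp.
  have [_] : noise_norm xi p (sigma p) /\ 0 < sigma p by apply: norm; lra.
  by rewrite sp ltNge sp0.
have [s [s0 hs]] := second_moment_lower_bound hp sp0.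
(* Bounds for [kappa_p * Cp] and [kappa_2 * C2], chosen before [sigma] is known: [s] stands in for
   the square of [sigma 2]. *)
pose k1 := (c2 p + c1 p * Num.max 1 (c1 p / (2 * sigma_p `^ p))) * Cp.
pose k2 := (c2 2 + c1 2 * Num.max 1 (c1 2 / (2 * s))) * C2.
exists (4 * ((ln 2)^-1 `^ (p / 2 - 1) * k1 + (2 * q) `^ (p / 2 - 1) * k2)
  + 2 + (C4 / 2 + 1)).
set Mb := _ + 2 + _.
move=> d T P Lam rk N eps theta xi sigma w J LamJ omega M x mhat.
move=> LamN Y penal _ N0 LamNN eps0 _ noise norm sigp w0 thetaoo part M0 MA x1.
move=> [mmhat selector].
have [norm2 sig2] : noise_norm xi 2 (sigma 2) /\ 0 < sigma 2.
  by apply: norm; lra.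
have [normp sigp0] : noise_norm xi p (sigma p) /\ 0 < sigma p.
  by apply: norm; lra.
have om0 j : 0 <= omega j by exact: (level_weight_ge0 _ part).
have nR : 0 < (N%:R : R) by rewrite ltr0n.
pose loss m o := \sum_(l <- LamN) w l * `|estimator (Y o) m l - theta l| `^ p.
pose Th := \sum_(l <- LamN) w l * `|theta l| `^ p.
have Th0 : 0 <= Th by apply: sumr_ge0 => l _; rewrite mulr_ge0 ?powR_ge0.
have loss0 m o : 0 <= loss m o.
  by apply: sumr_ge0 => l _; rewrite mulr_ge0 ?powR_ge0.
(* [b] is the signal beyond the first [N] coordinates, finite because the whole norm is, and part of
   the loss of every model. *)
have [b b0 bE] : exists2 b : R, 0 <= b &
    (\esum_(l in ~` [set` LamN]) (w l * `|theta l| `^ p)%:E = b%:E)%E.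
  have tail0 : (0 <= \esum_(l in ~` [set` LamN]) (w l * `|theta l| `^ p)%:E)%E.
    by apply: esum_ge0 => l _; rewrite lee_fin mulr_ge0 ?powR_ge0.
  have tailfin : (\esum_(l in ~` [set` LamN]) (w l * `|theta l| `^ p)%:E)%E
      \is a fin_num.
    rewrite ge0_fin_numE//; apply: le_lt_trans thetaoo.
    by rewrite (wnorm_pow_split p theta LamN w0) leeDr// lee_fin.
  exists (fine (\esum_(l in ~` [set` LamN]) (w l * `|theta l| `^ p)%:E)%E).
    exact: fine_ge0.
  by rewrite fineK.
have thetaE : wnorm_pow w p theta = (Th + b)%:E.
  by rewrite (wnorm_pow_split p theta LamN w0) bE.
have lossE m o : m \in M ->
    wnorm_pow w p (fun l => estimator (Y o) m l - theta l)%R = (loss m o + b)%:E.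
  move=> mM; rewrite (wnorm_pow_split p _ LamN w0) EFinD -bE.
  congr (_ + _)%E; apply: eq_esum => l /= lA.
  rewrite /estimator ifF ?sub0r ?normrN//; apply/negbTE/negP => lm.
  by apply: lA; exact: (fsubsetP (MA m mM)).
have mloss m : measurable_fun [set: T] (fun o => loss m o + b).
  by apply: measurable_funD => //; exact: measurable_loss.
pose a : R := N%:R `^ ((1 - q) / 2).
have a0 : 0 < a by exact: powR_gt0.
pose rem o := pco_remainder w LamJ omega x M LamN c1 c2 sigma p eps
  (2 * q * ln N%:R) ((ln N%:R / ln 2) `^ (p / 2 - 1)) a (Th + b)
  (fun l => xi l o).
have lnN0 : 0 <= ln (N%:R : R) by rewrite ln_ge0// ler1n.
have ln20 : 0 < ln (2 : R) by rewrite ln_gt0// ltr1n.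
pose remM := Mb * (N%:R `^ (1 - q) * (Th + b)
  + eps `^ p * Rrem_sharp LamJ omega x M w LamN p q N).
have rem_mean : mean_le P rem remM.
  have Thb0 : 0 <= Th + b by rewrite addr_ge0.
  have h1 j mj (mjM : mj \in traces (LamJ j) M) :=
    excp _ _ _ _ _ _ mj _ noise normp sigp0 (x1 j mj mjM).
  have h2 j mj (mjM : mj \in traces (LamJ j) M) :=
    exc2 _ _ _ _ _ _ mj _ noise norm2 sig2 (x1 j mj mjM).
  have h4 l : mean_le P (fun o => `|xi l o| `^ (2 * p)) C4.
    by apply: mom => t; case: noise => _ _; exact.
  have q0 : 0 <= q by lra.
  have hl l := noise_tail_log l q0 N0 noise.
  have := mean_le_remainder LamN eps0 (powR_ge0 (ln N%:R / ln 2) (p / 2 - 1)) a0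
    Thb0 w0 om0 h1 h2 h4 hl.
  apply: mean_le_weaken; rewrite LamNN -mulr_suml /remM /Rrem_sharp -/a.
  (* An actual index is required: [noise_norm] says something about [sigma 2] only through some
     [xi l]. *)
  have [l lA] : exists l, l \in LamN.
    by apply/fset0Pn; rewrite -cardfs_gt0 LamNN.
  have -> : kappa c1 c2 sigma p * Cp = k1 by rewrite /k1 -sigp.
  have kk2 : kappa c1 c2 sigma 2 * C2 <= k2.
    rewrite /k2 ler_wpM2r// kappa_le//.
    by apply: (hs _ _ P Lam xi _ l) => //; rewrite -sigp.
  have k10 : 0 <= k1.
    by rewrite /k1 -sigp mulr_ge0// ltW// (kappa_gt0 (c1 := c1)).
  have k20 : 0 <= k2.
    by apply: le_trans kk2; rewrite mulr_ge0// ltW// kappa_gt0.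
  have W0 : 0 <= \sum_(l <- LamN) w l by exact: sumr_ge0.
  have S0 : 0 <= Rrem LamJ omega x M.
    apply: sumr_ge0 => j _; rewrite mulr_ge0//; apply: sumr_ge0 => mj _.
    exact: expR_ge0.
  exact: (remainder_bound_le eps hp q1 nR lnN0 ln20 W0 Thb0 S0 k10 kk2 k20 C40
    (erefl a)).
have rem0 o : 0 <= rem o by case: rem_mean.
have oracle m : m \in M -> (risk P w p theta Y mhat
    <= (2 * C)%:E * (risk P w p theta Y (fun=> m) + (penal m)%:E) + remM%:E)%E.
  move=> mM.
  have penm : 0 <= penal m by apply: pen_ge0 x1 mM => //; exact: ltW.
  have C20' : 0 <= 2 * C by lra.
  have pen2 : 0 <= 2 * penal m by rewrite mulr_ge0.
  have mhatM o : mhat o \in M by case: (selector o).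
  have riskm : risk P w p theta Y (fun=> m) = (\int[P]_o (loss m o + b)%:E)%E.
    by apply: eq_integral => y _; exact: lossE.
  have -> : risk P w p theta Y mhat = (\int[P]_o (loss (mhat o) o + b)%:E)%E.
    by apply: eq_integral => y _; exact: lossE.
  have lossb0 m' o : (0 <= (loss m' o + b)%:E)%E by rewrite lee_fin addr_ge0.
  have [mpr pr0 prM] := mean_leD (mean_le_cst P pen2) rem_mean.
  apply: (@le_trans _ _ (\int[P]_o
      ((2 * C)%:E * (loss m o + b)%:E + (2 * penal m + rem o)%:E))%E).
    apply: ge0_le_integral => //.
    - apply/measurable_EFinP.
      exact: (measurable_random_model (g := fun m o => loss m o + b)).
    - apply: emeasurable_funD; last exact/measurable_EFinP.
      by apply: emeasurable_funM => //; exact/measurable_EFinP.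
    - move=> y _; rewrite -EFinM -EFinD lee_fin addrA.
      case: (selector y) => hM hmin.
      by apply: pco_pointwise => //; exact: hmin.
  have mloss2 : measurable_fun [set: T]
      (fun o => (2 * C)%:E * (loss m o + b)%:E)%E.
    by apply: emeasurable_funM => //; exact/measurable_EFinP.
  have loss2 o : [set: T] o -> (0 <= (2 * C)%:E * (loss m o + b)%:E)%E.
    by move=> _; rewrite mule_ge0.
  rewrite (ge0_integralD P measurableT loss2 mloss2); first last.
  - exact/measurable_EFinP.
  - by move=> y _; rewrite lee_fin.
  rewrite ge0_integralZl_EFin//; last exact/measurable_EFinP.
  rewrite -riskm; apply: le_trans (leeD2l _ prM) _.
  have risk0 : (0 <= risk P w p theta Y (fun=> m))%E.
    by rewrite riskm; apply: integral_ge0.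
  move: (risk P w p theta Y (fun=> m)) risk0 => r r0.
  (* Here [1 <= C] turns [2 * penal m] into [2 * C * penal m], so that one constant multiplies both
     risk and penalty. *)
  rewrite ge0_muleDr ?lee_fin// -addeA leeD2l//.
  rewrite -EFinM -EFinD lee_fin lerD2r ler_wpM2r//; lra.
(* A positive constant passes inside the infimum, and the finite [remM] can be subtracted, which
   leaves the inequality for each single [m]. *)
rewrite -ereal_inf_pZl; last by lra.
have -> : (Mb%:E * ((N%:R `^ (1 - q))%:E * wnorm_pow w p theta
    + (eps `^ p * Rrem_sharp LamJ omega x M w LamN p q N)%:E) = remM%:E)%E.
  by rewrite thetaE.
rewrite -leeBlDr//.
apply/ereal_infP => _ [_ [m mM <-] <-].
by rewrite leeBlDr//; exact: oracle.
Qed.
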